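(* Let $R$ be a (commutative) Noetherian local ring. Then the dimension of the topological space $QPrim(R)$ is finite.
   Context: All rings are commutative with identity. An ideal $I$ of $R$ is quasi-primary if its radical $\sqrt{I}$ is a prime ideal; $QPrim(R)$ denotes the set of all quasi-primary ideals of $R$. It carries the Zariski topology, whose closed sets are the sets $V_q(I)=\{Q\in QPrim(R): I\subseteq \sqrt{Q}\}$ for ideals $I$ of $R$. A topological space is irreducible if it is nonempty and cannot be written as a union of two proper closed subsets. The dimension of a topological space $X$ is the number $n$ such that $X$ has a chain of irreducible closed sets $V_1\subset V_2\subset\cdots\subset V_n$ (strict inclusions) and no such chain has more than $n$ terms. *)

(* Defs.v *)
From HB Require Import structures.
From mathcomp Require Import all_boot all_order all_algebra.
From mathcomp Require Import all_classical topology.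

Set Implicit Arguments.
Unset Strict Implicit.
Unset Printing Implicit Defensive.

Import GRing.Theory.

Local Open Scope classical_set_scope.
Local Open Scope ring_scope.

Section Ideals.
Variable R : comPzRingType.
Implicit Types (I J P Q M : set R).

(* The [idealr] structure of ring_quotient only covers proper ideals, given by
   boolean predicates; here the unit ideal must be allowed, since it defines
   the empty closed subset of QPrim(R). *)
Definition ideal I : Prop :=
  [/\ I 0, (forall x y, I x -> I y -> I (x + y))
         & (forall a x, I x -> I (a * x))].

Definition prime_ideal P : Prop :=
  [/\ ideal P, P <> setT & forall x y, P (x * y) -> P x \/ P y].

Definition maximal_ideal M : Prop :=
  [/\ ideal M, M <> setT &
      forall J, ideal J -> M `<=` J -> J = M \/ J = setT].

Definition radical I : set R :=
  [set x | exists2 n : nat, (0 < n)%N & I (x ^+ n)].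

Definition quasi_primary Q : Prop := ideal Q /\ prime_ideal (radical Q).

End Ideals.

Definition noetherian (R : comPzRingType) : Prop :=
  forall I : set R, ideal I ->
    exists s : seq R, I = smallest (@ideal R) [set` s].

(* A local ring is automatically nonzero: the zero ring has no maximal ideal. *)
Definition local_ring (R : comPzRingType) : Prop :=
  exists! M : set R, maximal_ideal M.

Record QPrim (R : comPzRingType) : Type := MkQPrim {
  qprim_ideal : set R;
  qprim_ideal_quasi_primary : quasi_primary qprim_ideal }.

HB.instance Definition _ (R : comPzRingType) := gen_eqMixin (QPrim R).
HB.instance Definition _ (R : comPzRingType) := gen_choiceMixin (QPrim R).

Definition Vq (R : comPzRingType) (I : set R) : set (QPrim R) :=
  [set Q | I `<=` radical (qprim_ideal Q)].

Section ZariskiTopology.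
Variable R : comPzRingType.

Definition qprim_open (U : set (QPrim R)) : Prop :=
  exists2 I : set R, ideal I & U = ~` Vq I.

Lemma ideal_setT : ideal [set: R].
Proof. by []. Qed.

Lemma ideal_setI (I J : set R) : ideal I -> ideal J -> ideal (I `&` J).
Proof.
move=> [I0 ID IM] [J0 JD JM]; split=> //.
- by move=> x y [? ?] [? ?]; split; [exact: ID|exact: JD].
- by move=> a x [? ?]; split; [exact: IM|exact: JM].
Qed.

Lemma ideal_smallest (A : set R) : ideal (smallest (@ideal R) A).
Proof.
split=> [I [[]]//|x y Ax Ay I [iI AI]|a x Ax I [iI AI]].
- by case: (iI) => _ + _; apply; [exact: Ax|exact: Ay].
- by case: (iI) => _ _; apply; exact: Ax.
Qed.

Lemma prime_radical (Q : QPrim R) : prime_ideal (radical (qprim_ideal Q)).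
Proof. by case: Q => Q []. Qed.

Lemma Vq_setT : Vq [set: R] = set0.
Proof.
rewrite -subset0 => Q TQ; have [_ + _] := prime_radical Q.
by apply; rewrite -subTset.
Qed.

Lemma Vq_setI (I J : set R) : ideal I -> ideal J ->
  Vq (I `&` J) = Vq I `|` Vq J.
Proof.
move=> [_ _ IM] [_ _ JM]; apply/seteqP; split=> [Q IJQ|Q [IQ|JQ]].
- have [_ _ Qprime] := prime_radical Q.
  apply/or_asboolP; rewrite -implyNb; apply/implyP => /asboolPn.
  move=> /existsNP[x /not_implyP[Ix Qx]]; apply/asboolP => y Jy.
  have : radical (qprim_ideal Q) (x * y).
    by apply: IJQ; split; [rewrite mulrC; exact: IM|exact: JM].
  by case/Qprime.
- by move=> x [Ix _]; exact: IQ.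
- by move=> x [_ Jx]; exact: JQ.
Qed.

Lemma Vq_bigcup (K : Type) (I : K -> set R) :
  Vq (smallest (@ideal R) (\bigcup_k I k)) = \bigcap_k Vq (I k).
Proof.
apply/seteqP; split=> [Q IQ k _ x Ikx|Q IQ x].
- by apply: IQ => J [_]; apply; exists k.
- apply; split; first by have [] := prime_radical Q.
  by move=> y [k _ Iky]; exact: (IQ k).
Qed.

Lemma qprim_openT : qprim_open setT.
Proof. by exists setT; [exact: ideal_setT|rewrite Vq_setT setC0]. Qed.

Lemma qprim_openI : setI_closed qprim_open.
Proof.
move=> _ _ [I iI ->] [J iJ ->]; exists (I `&` J); first exact: ideal_setI.
by rewrite Vq_setI// setCU.
Qed.

Lemma qprim_open_bigU (K : Type) (f : K -> set (QPrim R)) :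
  (forall k, qprim_open (f k)) -> qprim_open (\bigcup_k f k).
Proof.
move=> fo.
have {fo}/choice[I fI] : forall k, exists I : set R, ideal I /\ f k = ~` Vq I.
  by move=> k; have [I ? ?] := fo k; exists I.
exists (smallest (@ideal R) (\bigcup_k I k)); first exact: ideal_smallest.
rewrite Vq_bigcup setC_bigcap; apply: eq_bigcupr => k _.
by have [] := fI k.
Qed.

HB.instance Definition _ := @isOpenTopological.Build (QPrim R)
  qprim_open qprim_openT qprim_openI qprim_open_bigU.

Lemma closed_QPrimP (F : set (QPrim R)) :
  closed F <-> exists2 I : set R, ideal I & F = Vq I.
Proof.
rewrite -openC; split=> [[I iI FI]|[I iI ->]]; exists I => //.
by rewrite -[F]setCK FI setCK.
Qed.

End ZariskiTopology.

Definition irreducible_space (T : topologicalType) : Prop :=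
  [set: T] !=set0 /\
  ~ exists A B : set T,
      [/\ closed A, closed B, A `<` setT, B `<` setT & A `|` B = setT].

(* [set_type A] carries the topology induced from [T]. *)
Definition irreducible_set (T : topologicalType) (A : set T) : Prop :=
  irreducible_space (set_type A).

Definition irreducible_closed_chain (T : topologicalType) (n : nat)
    (V : 'I_n -> set T) : Prop :=
  (forall i, closed (V i) /\ irreducible_set (V i)) /\
  (forall i j : 'I_n, (i < j)%N -> V i `<` V j).

(* The dimension counts the terms of a chain V_1 < ... < V_n,
   not the strict inclusions. *)
Definition has_dimension (T : topologicalType) (n : nat) : Prop :=
  (exists V : 'I_n -> set T, irreducible_closed_chain V) /\
  (forall (m : nat) (V : 'I_m -> set T),
     irreducible_closed_chain V -> (m <= n)%N).

(* Main.v *)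
From HB Require Import structures.
Require Import Defs.
From mathcomp Require Import all_boot all_order all_algebra.
From mathcomp Require Import all_classical topology.
From mathcomp Require Import ring zify.

(** The theorem reduces to the finiteness of the Krull dimension of a
    Noetherian local ring. If V is an irreducible closed subset of QPrim(R),
    the intersection of the radicals of the members of V is a prime ideal
    ([prime_vanishing]) that determines V ([Vq_vanishing]); a strict chain of
    irreducible closed sets thus becomes a strict chain of primes, in the
    opposite order.

    Let the maximal ideal M be generated by d elements. A strict chain of primes
    P_0 < ... < P_n is shown to have n <= d by estimating the length of
    R / (P + M ^ N) as N grows, without Hilbert polynomials.
    - Upper bound ([length_le_ipow]): M ^ N contains the N-th powers of the d
      generators, and modulo these the length is at most N ^ d.
    - Lower bound ([growsS]): if x is in P_1 but not in P_0, the exact sequence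
      of multiplication by x bounds the length for P_0 at N from below by the
      length for P_1 at N plus the length of R / (P_0 + M ^ N : x). By Artin-Rees
      ([artin_rees_colon]) that last ideal lies in P_0 + M ^ (N - c) for a
      constant c. Iterating q times multiplies the lower bound by q, as soon as
      N exceeds a fixed multiple of q; so a chain with n strict inclusions above
      P forces length at least q ^ n for N of order q.
    Comparing the two bounds for large q gives n <= d ([grows_le]).

    Lengths are never defined as numbers: only lists of elements, each outside
    the ideal generated by the previous ones, are compared ([indep]). Artin-Rees
    comes from Hilbert's basis theorem applied to the Rees algebra, the subring
    of R[t] whose degree k coefficients lie in M ^ k. *)

Set Implicit Arguments.
Unset Strict Implicit.
Unset Printing Implicit Defensive.

Import GRing.Theory.

Local Open Scope classical_set_scope.
Local Open Scope ring_scope.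

(** * Ideals, sums, quotients and powers *)

Notation gen := (smallest (@ideal _)).

Section IdealOperations.
Variable R : comPzRingType.
Implicit Types (I J K L M P : set R) (a b u v x y : R) (s : seq R).

Lemma ideal0 I : ideal I -> I 0.
Proof. by case. Qed.

Lemma idealD I x y : ideal I -> I x -> I y -> I (x + y).
Proof. by case=> _ + _; apply. Qed.

Lemma idealM I a x : ideal I -> I x -> I (a * x).
Proof. by case=> _ _; apply. Qed.

Lemma idealMr I a x : ideal I -> I x -> I (x * a).
Proof. by rewrite mulrC; exact: idealM. Qed.

Lemma idealB I x y : ideal I -> I x -> I y -> I (x - y).
Proof. by move=> iI Ix Iy; rewrite -[y]mul1r -mulNr; apply: idealD => //; exact: idealM.
Qed.

Lemma ideal1 I : ideal I -> I 1 -> I = setT.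
Proof.
by move=> iI I1; rewrite -subTset => x _; rewrite -[x]mulr1; exact: idealM.
Qed.

Lemma gen_sub I (A : set R) : ideal I -> A `<=` I -> gen A `<=` I.
Proof. exact: smallest_sub. Qed.

Lemma gen_mono (A B : set R) : A `<=` B -> gen A `<=` gen B.
Proof. by move=> AB; apply: sub_smallest2r => //; exact: ideal_smallest. Qed.

Lemma mem_gen (A : set R) x : A x -> gen A x.
Proof. exact: sub_gen_smallest. Qed.

Definition colon K u : set R := [set a | K (a * u)].

Lemma ideal_colon K u : ideal K -> ideal (colon K u).
Proof.
move=> iK; split=> [|x y Kx Ky|a x Kx]; rewrite /colon/=.
- by rewrite mul0r; exact: ideal0.
- by rewrite mulrDl; exact: idealD.
- by rewrite -mulrA; exact: idealM.
Qed.

Definition isum I J : set R := [set x | exists2 a, I a & J (x - a)].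

Lemma ideal_isum I J : ideal I -> ideal J -> ideal (isum I J).
Proof.
move=> iI iJ; split=> [|x y [a Ia Jxa] [b Ib Jyb]|r x [a Ia Jxa]].
- by exists 0; rewrite ?subr0; exact: ideal0.
- exists (a + b); first exact: idealD.
  by rewrite opprD addrACA; exact: idealD.
- by exists (r * a); rewrite -?mulrBr; exact: idealM.
Qed.

Lemma sub_isuml I J : ideal J -> I `<=` isum I J.
Proof. by move=> iJ x Ix; exists x; rewrite ?subrr//; exact: ideal0. Qed.

Lemma sub_isumr I J : ideal I -> J `<=` isum I J.
Proof. by move=> iI x Jx; exists 0; rewrite ?subr0//; exact: ideal0. Qed.

Lemma isum_sub I J K : ideal K -> I `<=` K -> J `<=` K -> isum I J `<=` K.
Proof.
by move=> iK IK JK x [a /IK Ka /JK Kxa]; rewrite -(subrK a x); exact: idealD.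
Qed.

Definition adjoin K u : set R := [set x | exists a, K (x - a * u)].

Lemma ideal_adjoin K u : ideal K -> ideal (adjoin K u).
Proof.
move=> iK; split=> [|x y [a Kx] [b Ky]|r x [a Kx]].
- by exists 0; rewrite mul0r subr0; exact: ideal0.
- by exists (a + b); rewrite mulrDl opprD addrACA; exact: idealD.
- by exists (r * a); rewrite -mulrA -mulrBr; exact: idealM.
Qed.

Lemma sub_adjoin K u : K `<=` adjoin K u.
Proof. by move=> x Kx; exists 0; rewrite mul0r subr0. Qed.

Lemma mem_adjoin K u : ideal K -> adjoin K u u.
Proof. by move=> iK; exists 1; rewrite mul1r subrr; exact: ideal0. Qed.

Lemma adjoin_sub K u L : ideal L -> K `<=` L -> L u -> adjoin K u `<=` L.
Proof.
move=> iL KL Lu x [a /KL Lx]; rewrite -(subrK (a * u) x).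
by apply: idealD => //; exact: idealM.
Qed.

Lemma adjoin_mono K L u : K `<=` L -> adjoin K u `<=` adjoin L u.
Proof. by move=> KL x [a /KL Lx]; exists a. Qed.

Fixpoint ipow M n : set R :=
  if n is n'.+1 then gen [set x | exists a b, [/\ M a, ipow M n' b & x = a * b]]
  else setT.

Lemma ideal_ipow M n : ideal (ipow M n).
Proof. by case: n => [|n]; [exact: ideal_setT|exact: ideal_smallest]. Qed.

Lemma ipow_mulS M n a b : M a -> ipow M n b -> ipow M n.+1 (a * b).
Proof. by move=> Ma Mb; apply: mem_gen; exists a, b. Qed.

Lemma ipow_exp M n a : M a -> ipow M n (a ^+ n).
Proof. by move=> Ma; elim: n => // n IH; rewrite exprS; exact: ipow_mulS. Qed.

Lemma ipow_le M m n : (m <= n)%N -> ipow M n `<=` ipow M m.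
Proof.
elim: n m => [|n IH] [|m]//= mn; apply: gen_mono => x [a [b [Ma Mb ->]]].
by exists a, b; split=> //; exact: (IH m).
Qed.

Lemma ipow_mul M m n a b :
  ipow M m a -> ipow M n b -> ipow M (m + n) (a * b).
Proof.
move=> Ma Mb; elim: m a Ma => [|m IH] a Ma; first by apply: idealM Mb; exact: ideal_ipow.
suff : ipow M m.+1 `<=` colon (ipow M (m + n).+1) b by apply.
apply: gen_sub; first exact/ideal_colon/ideal_ipow.
move=> _ [c [d [Mc Md ->]]]; rewrite /colon/= -mulrA.
by apply: ipow_mulS => //; exact: IH.
Qed.

Lemma ipow_sub M n : ideal M -> (0 < n)%N -> ipow M n `<=` M.
Proof.
case: n => // n iM _; apply: gen_sub => // _ [a [b [Ma _ ->]]].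
exact: idealMr.
Qed.

Lemma prime1 P : prime_ideal P -> ~ P 1.
Proof. by move=> [iP PT _] /(ideal1 iP). Qed.

End IdealOperations.

(** * Lengths of quotients by an ideal *)

Section Length.
Variable R : comPzRingType.
Implicit Types (K L M : set R) (b u : R) (s : seq R).

(** A list of size n satisfying this predicate is the same thing as a strict
    chain K = K_0 < K_1 < ... < K_n of ideals, each obtained from the previous
    one by adjoining one element; so the maximal size is the length of R / K. *)
Fixpoint indep K s : Prop :=
  if s is b :: s' then ~ K b /\ indep (adjoin K b) s' else True.

Definition length_le K n := forall s, indep K s -> (size s <= n)%N.
Definition length_ge K n := exists2 s, indep K s & (n <= size s)%N.

Lemma indep_mono K L s : K `<=` L -> indep L s -> indep K s.
Proof.
elim: s K L => //= b s IH K L KL [Lb Ls]; split; first by move/KL.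
by apply: IH Ls; exact: adjoin_mono.
Qed.

Lemma length_le_mono K L n : K `<=` L -> length_le K n -> length_le L n.
Proof. by move=> KL Kn s Ls; apply: Kn; exact: (indep_mono KL). Qed.

Lemma length_ge_mono K L n : K `<=` L -> length_ge L n -> length_ge K n.
Proof. by move=> KL [s Ls ns]; exists s => //; exact: (indep_mono KL). Qed.

(** One half of the additivity of length along the exact sequence
    0 -> R / (K : u) -> R / K -> R / (K + u) -> 0. Each element b of the list
    either remains outside K + u, or is congruent to some a * u modulo K, in
    which case a extends the list for K : u. *)
Lemma indep_split K u s : ideal K -> indep K s ->
  exists s1 s2, [/\ indep (adjoin K u) s1, indep (colon K u) s2
                  & (size s <= size s1 + size s2)%N].
Proof.
elim: s K => [|b s IH] K iK /= => [_|[Kb Ks]]; first by exists [::], [::].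
have [s1 [s2 [is1 is2 ss]]] := IH _ (ideal_adjoin b iK) Ks.
have [Kub|Kub] := pselect (adjoin K u b).
  have [a Ka] := Kub.
  exists s1, (a :: s2); split=> /=.
  - apply: indep_mono is1; apply: adjoin_mono; exact: sub_adjoin.
  - split.
      move=> /= aK; apply: Kb; rewrite -(subrK (a * u) b); exact: idealD.
    apply: indep_mono is2; apply: adjoin_sub.
    + by apply: ideal_colon; exact: ideal_adjoin.
    + by move=> x Kx; apply: sub_adjoin; exact: Kx.
    + by exists 1; rewrite mul1r -opprB -mulN1r; exact: idealM.
  - by rewrite addnS.
exists (b :: s1), s2; split=> //=.
- split=> //; apply: indep_mono is1; apply: adjoin_sub.
  + by do 2!apply: ideal_adjoin.
  + by apply: adjoin_mono; exact: sub_adjoin.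
  + by apply: sub_adjoin; exact: mem_adjoin.
- by apply: indep_mono is2 => x Kx; apply: sub_adjoin; exact: Kx.
Qed.

Lemma length_le_split K u m n : ideal K ->
  length_le (adjoin K u) m -> length_le (colon K u) n -> length_le K (m + n).
Proof.
move=> iK Km Kn s /(indep_split u iK)[s1 [s2 [/Km s1m /Kn s2n]]].
by move=> /leq_trans; apply; exact: leq_add.
Qed.

(** The other half of additivity: a list for K : u, multiplied by u, climbs from
    K up to K + u, after which a list for K + u takes over. *)
Lemma indep_join K u s1 s2 : ideal K ->
  indep (adjoin K u) s1 -> indep (colon K u) s2 ->
  indep K ([seq a * u | a <- s2] ++ s1).
Proof.
elim: s2 K => [|a s2 IH] K iK /= is1.
  by move=> _; exact: indep_mono (@sub_adjoin _ K u) is1.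
move=> [Ka is2]; split=> //.
apply: IH; first exact: ideal_adjoin.
- apply: indep_mono is1; apply: adjoin_sub; first exact: ideal_adjoin.
    apply: adjoin_sub; [exact: ideal_adjoin|exact: sub_adjoin|].
    apply: idealM; [exact: ideal_adjoin|exact: mem_adjoin].
  exact: mem_adjoin.
- by apply: indep_mono is2 => x [r Kr]; exists r; rewrite /colon/= mulrBl -mulrA.
Qed.

Lemma length_ge_split K u m n : ideal K ->
  length_ge (adjoin K u) m -> length_ge (colon K u) n -> length_ge K (m + n).
Proof.
move=> iK [s1 is1 ms1] [s2 is2 ns2]; exists ([seq a * u | a <- s2] ++ s1).
  exact: indep_join.
by rewrite size_cat size_map addnC leq_add.
Qed.

(** If u ^ n is in K, then R / K is filtered by the n quotients
    (K + u ^ i) / (K + u ^ i.+1), each a quotient of R / (K + u). *)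
Lemma length_le_exp K u m n : ideal K ->
  length_le (adjoin K u) m -> K (u ^+ n) -> length_le K (n * m).
Proof.
elim: n K => [|n IH] K iK Km Kun.
  by case=> // b s [Kb _]; exfalso; apply: Kb; rewrite (ideal1 iK Kun).
rewrite mulSn; apply: (length_le_split iK Km).
apply: IH; first exact: ideal_colon.
  apply: length_le_mono Km; apply: adjoin_mono => x Kx.
  exact: idealMr.
by rewrite /colon/= -exprSr.
Qed.

(** Allowing every ideal L above K in the hypothesis makes it stable when a
    generator is adjoined to K, which is what the induction on [y] requires. *)
Lemma length_le_exps (y : seq R) K m n : ideal K ->
    (forall L, ideal L -> K `<=` L -> [set` y] `<=` L -> length_le L m) ->
    (forall u, u \in y -> K (u ^+ n)) ->
  length_le K (n ^ size y * m).
Proof.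
elim: y K => [|u y IH] K iK /= Km Kyn.
  by rewrite mul1n; apply: Km.
rewrite expnS -mulnA; apply: (@length_le_exp _ u) => //; last first.
  by apply: Kyn; rewrite mem_head.
apply: IH; first exact: ideal_adjoin.
  move=> L iL KL yL; apply: Km => //.
    by move=> x Kx; apply/KL/sub_adjoin.
  move=> x; rewrite /= inE => /orP[/eqP->|/yL//].
  exact/KL/mem_adjoin.
by move=> v vy; apply/sub_adjoin/Kyn; rewrite inE vy orbT.
Qed.

Lemma length_le_maximal M : maximal_ideal M -> length_le M 1.
Proof.
move=> [iM _ Mmax] [|b [|b' s]]//= [Mb [Mb' _]]; exfalso.
have [bM|bT] := Mmax _ (ideal_adjoin b iM) (@sub_adjoin _ M b).
  by apply: Mb; rewrite -bM; exact: mem_adjoin.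
by apply: Mb'; rewrite bT.
Qed.

(** M ^ n contains the n-th powers of the generators. Cutting down to these
    powers, instead of to all monomials of degree n, gives a bound polynomial in
    n of degree [size y] without counting monomials. *)
Lemma length_le_ipow (y : seq R) M n : maximal_ideal M -> M = gen [set` y] ->
  length_le (ipow M n) (n ^ size y).
Proof.
move=> Mmax My; rewrite -[X in length_le _ X]muln1.
apply: length_le_exps => [|L iL _ yL|u uy]; first exact: ideal_ipow.
- apply: length_le_mono (length_le_maximal Mmax).
  by rewrite My; exact: gen_sub.
- by apply: ipow_exp; rewrite My; exact: mem_gen.
Qed.

End Length.

(** * Ascending chains and Hilbert's basis theorem *)

Section AscendingChains.
Variable R : comPzRingType.

Lemma ideal_bigcup_nondecreasing (J : nat -> set R) :
  (forall n, ideal (J n)) -> (forall m n, (m <= n)%N -> J m `<=` J n) ->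
  ideal (\bigcup_n J n).
Proof.
move=> iJ J_le; split=> [|x y [m _ Jx] [n _ Jy]|a x [n _ Jx]].
- by exists 0%N => //; exact: ideal0.
- exists (maxn m n) => //.
  by apply: idealD => //; [apply: J_le Jx|apply: J_le Jy];
    rewrite ?leq_maxl ?leq_maxr.
- by exists n => //; exact: idealM.
Qed.

(** The members of a finite generating set of the union all lie in one term of
    the chain, which is then the whole union. *)
Lemma noetherian_acc (J : nat -> set R) : noetherian R ->
  (forall n, ideal (J n)) -> (forall m n, (m <= n)%N -> J m `<=` J n) ->
  exists n, J n.+1 `<=` J n.
Proof.
move=> hN iJ J_le.
have [s Us] := hN _ (ideal_bigcup_nondecreasing iJ J_le).
suff [n sn] : exists n, [set` s] `<=` J n.
  exists n => x Jx; apply: (gen_sub (iJ n) sn).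
  by rewrite -Us; exists n.+1.
have : [set` s] `<=` \bigcup_n J n by rewrite Us => x; exact: mem_gen.
elim: s {Us} => [|u s IH] sU; first by exists 0%N.
have [x xs|n sn] := IH; first by apply: sU; rewrite /= inE xs orbT.
have [m _ Ju] : (\bigcup_n J n) u by apply: sU; rewrite /= mem_head.
exists (maxn m n) => x; rewrite /= inE => /orP[/eqP->|/sn].
  by apply: J_le Ju; exact: leq_maxl.
by apply: J_le; exact: leq_maxr.
Qed.

(** Otherwise proper ideals above I could be enlarged forever, against the
    ascending chain condition. *)
Lemma proper_sub_maximal (I : set R) : noetherian R -> ideal I -> ~ I 1 ->
  exists2 M : set R, maximal_ideal M & I `<=` M.
Proof.
move=> hN iI I1; apply: contrapT => noM.
have /choice[next nextP] : forall K : set R, exists K' : set R,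
    ideal K -> ~ K 1 -> I `<=` K ->
    [/\ ideal K', ~ K' 1, I `<=` K', K `<=` K' & ~ K' `<=` K].
  move=> K; have [[iK [K1 IK]]|nK] := pselect (ideal K /\ ~ K 1 /\ I `<=` K);
    last by exists K => ? ? ?; exfalso; apply: nK.
  apply: contrapT => noK'; apply: noM; exists K => //; split=> //.
    by move=> KT; rewrite KT in K1; exact: K1.
  move=> J iJ KJ; have [J1|J1] := pselect (J 1); first by right; exact: ideal1.
  left; apply/seteqP; split=> //; apply: contrapT => JK; apply: noK'.
  by exists J => _ _ _; split=> //; exact: subset_trans KJ.
pose J n := iter n next I.
have JP n : [/\ ideal (J n), ~ J n 1 & I `<=` J n].
  by elim: n => [|n [iJ J1 IJ]]; [split|have [] := nextP (J n) iJ J1 IJ].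
have JS n : J n `<=` J n.+1 by have [iJ J1 IJ] := JP n; have [] := nextP _ iJ J1 IJ.
have [|m n /subnK<-|n] := @noetherian_acc J hN.
- by move=> n; have [] := JP n.
- by elim: (n - m)%N => // k IH x /IH; exact: JS.
- by have [iJ J1 IJ] := JP n; have [] := nextP _ iJ J1 IJ.
Qed.

Lemma local_sub_maximal (M I : set R) : noetherian R -> local_ring R ->
  maximal_ideal M -> ideal I -> ~ I 1 -> I `<=` M.
Proof.
move=> hN [M0 [_ M0_uniq]] /M0_uniq<- iI I1.
by have [M' /M0_uniq<-] := proper_sub_maximal hN iI I1.
Qed.

Lemma ex_minimal (T : Type) (mu : T -> nat) (P : T -> Prop) :
  (exists x, P x) -> exists2 x, P x & forall y, P y -> (mu x <= mu y)%N.
Proof.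
move=> [x Px].
have [|_ /asboolP[y Py <-] y_min] :=
  @ex_minnP (fun n : nat => `[< exists2 y, P y & mu y = n >]).
  by exists (mu x); apply/asboolP; exists x.
by exists y => // z Pz; apply: y_min; apply/asboolP; exists z.
Qed.

(** Greedy choice: [g k] has minimal measure among the elements of I outside the
    ideal generated by the earlier choices. With the size of polynomials as the
    measure, this is the sequence used in the basis theorem. *)
Lemma not_fg_sequence (mu : R -> nat) (I : set R) :
  ideal I -> ~ (exists s : seq R, I = gen [set` s]) ->
  exists g : nat -> R, forall k,
    [/\ I (g k), ~ gen [set` mkseq g k] (g k)
      & forall x, I x -> ~ gen [set` mkseq g k] x -> (mu (g k) <= mu x)%N].
Proof.
move=> iI nfg.
have /choice[F FP] : forall s : seq R, exists x, [set` s] `<=` I ->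
    [/\ I x, ~ gen [set` s] x
      & forall z, I z -> ~ gen [set` s] z -> (mu x <= mu z)%N].
  move=> s; have [sI|sI] := pselect ([set` s] `<=` I); last by exists 0.
  have [|x [Ix sx] x_min] := @ex_minimal R mu (fun x => I x /\ ~ gen [set` s] x).
    apply: contrapT => nox; apply: nfg; exists s; apply/seteqP; split.
      by move=> x Ix; apply: contrapT => sx; apply: nox; exists x.
    exact: gen_sub.
  by exists x => _; split=> // z Iz sz; exact: x_min.
pose G k := iter k (fun s => rcons s (F s)) [::].
exists (F \o G) => k.
have -> : mkseq (F \o G) k = G k by elim: k => //= k IH; rewrite mkseqS IH.
apply: (FP (G k)); elim: k => // k IH x.
rewrite /= mem_rcons inE => /orP[/eqP->|]; last exact: IH.
by have [] := FP _ IH.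
Qed.

Lemma mkseq_sub (g : nat -> R) m n :
  (m <= n)%N -> [set` mkseq g m] `<=` [set` mkseq g n].
Proof.
move=> mn x /= /mapP[i]; rewrite mem_iota => /andP[_ im] ->.
by apply: map_f; rewrite mem_iota /= (leq_trans im).
Qed.

End AscendingChains.

Section HilbertBasis.
Variable R : comNzRingType.

(** If I is not finitely generated, choose g_0, g_1, ... in I greedily by degree.
    Some leading coefficient of g_n is a combination of the earlier ones;
    subtracting from g_n the corresponding combination of multiples of the
    earlier g_i, shifted to the degree of g_n, yields an element that is still
    outside their ideal but of smaller degree. *)
Lemma hilbert_basis : noetherian R -> noetherian {poly R}.
Proof.
move=> hN I iI; apply: contrapT => nfg.
have [g gP] := not_fg_sequence (fun p : {poly R} => size p) iI nfg.

pose a i := lead_coef (g i).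
have iS k : ideal (gen [set` mkseq g k]) by exact: ideal_smallest.
have [|m n mn|n] := @noetherian_acc R (fun n => gen [set` mkseq a n]) hN.
- by move=> n; exact: ideal_smallest.
- by apply: gen_mono; exact: mkseq_sub.
move=> /(_ (a n)) an.
have {an} : gen [set` mkseq a n] (a n).
  by apply: an; apply: mem_gen; rewrite /= mkseqS mem_rcons mem_head.
have g_gt0 k : (0 < size (g k))%N.
  rewrite lt0n size_poly_eq0; apply/eqP => gk0.
  by have [_ + _] := gP k; rewrite gk0; apply; exact: ideal0.
have g_le i k : (i <= k)%N -> (size (g i) <= size (g k))%N.
  move=> ik; have [_ _] := gP i; apply; first by have [] := gP k.
  have [_ gk _] := gP k; apply: contra_not gk; apply: gen_mono.
  exact: mkseq_sub.
set d := size (g n).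
(* The possible coefficients in the degree of g_n, for polynomials of at most
   that degree in the ideal of the earlier g_i. *)
pose K : set R := [set b | exists p,
  [/\ gen [set` mkseq g n] p, (size p <= d)%N & p`_d.-1 = b]].
have iK : ideal K.
  split=> [|_ _ [p [Sp pd <-]] [q [Sq qd <-]]|r _ [p [Sp pd <-]]].
  - by exists 0; split; [exact: (ideal0 (iS n))|rewrite size_poly0|rewrite coef0].
  - exists (p + q); split; [exact: (idealD (iS n))| |by rewrite coefD].
    by apply: leq_trans (size_polyD _ _) _; rewrite geq_max pd.
  - exists (r%:P * p); split; [exact: (idealM _ (iS n))| |by rewrite coefCM].
    by rewrite mul_polyC; apply: leq_trans (size_scale_leq _ _) _.
have : gen [set` mkseq a n] `<=` K.
  apply: gen_sub => // _ /= /mapP[i + ->]; rewrite mem_iota => /= i_n.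
  have gid := g_le _ _ (ltnW i_n).
  exists ('X^(d - size (g i)) * g i); split.
  - apply: (idealM _ (iS n)); apply: mem_gen; rewrite /=.
    by apply: map_f; rewrite mem_iota.
  - apply: leq_trans (size_polyMleq _ _) _.
    by rewrite size_polyXn addSn /= subnK.
  - rewrite coefXnM /a lead_coefE; have := g_gt0 i; move: gid; rewrite -/d.
    case: (size (g i)) => // e ed _; rewrite /= ifN; last by lia.
    by congr (_`_ _); lia.
move=> sub /sub[p [Sp pd pa]].
have [Ig ng g_min] := gP n.
have : (d <= size (g n - p)%R)%N.
  apply: g_min.
    apply: (idealB iI) => //; apply: (gen_sub iI _ Sp) => _ /= /mapP[i _ ->].
    by have [] := gP i.
  by move=> Sgp; apply: ng; rewrite -(subrK p (g n)); exact: (idealD (iS n)).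
apply/negP; rewrite -ltnNge -(prednK (g_gt0 n : 0 < d)%N) ltnS; apply/leq_sizeP => j.
rewrite leq_eqVlt coefB => /orP[/eqP<-|]; first by rewrite pa /a lead_coefE subrr.
rewrite (prednK (g_gt0 n : 0 < d)%N) => dj; rewrite !nth_default ?subrr//.
exact: leq_trans pd _.
Qed.

End HilbertBasis.

(** * The Artin-Rees lemma *)

Section ArtinRees.
Variable R : comNzRingType.

(** The image of [phi] is the subalgebra of the Rees algebra of M generated by the
    elements a * t for a in y. It is presented as an image of a Noetherian ring
    because Hilbert's theorem, applied once per generator, concerns polynomial
    rings and not subrings of R[t]. *)
Lemma rees_presentation (M : set R) (y : seq R) :
    noetherian R -> ideal M -> [set` y] `<=` M ->
  exists (S : comNzRingType) (phi : {rmorphism S -> {poly R}}),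
    [/\ noetherian S, forall b, exists z, phi z = b%:P,
        forall a, a \in y -> exists z, phi z = a *: 'X
      & forall z k, ipow M k (phi z)`_k].
Proof.
move=> hN iM; elim: y => [|a y IH] yM.
  exists R, (GRing.RMorphism.clone _ _ (@polyC R) _); split=> // [b|z [|k]].
  - by exists b.
  - by [].
  - by rewrite (coefC z); exact: (ideal0 (ideal_ipow M _)).
have [|S [phi [hS phiC phiX phiM]]] := IH.
  by move=> x xy; apply: yM; rewrite /= inE xy orbT.
have cfu : commr_rmorph phi (a *: 'X) by move=> z; exact: mulrC.
exists {poly S}, (GRing.RMorphism.clone _ _ (horner_morph cfu) _); split.
- exact: hilbert_basis.
- by move=> b; have [z <-] := phiC b; exists z%:P; exact: horner_morphC.
- move=> b; rewrite inE => /orP[/eqP->|/phiX[z <-]].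
    by exists 'X; exact: horner_morphX.
  by exists z%:P; exact: horner_morphC.
elim/poly_ind => [|p c IHp] k.
  by rewrite rmorph0 coef0; exact: (ideal0 (ideal_ipow M _)).
rewrite rmorphD rmorphM /= horner_morphX horner_morphC coefD.
apply: (idealD (ideal_ipow M k)) => //.
rewrite -scalerAr coefZ coefMX; case: k => // k.
by apply: ipow_mulS => //; apply: yM; rewrite /= mem_head.
Qed.

(** As [phi] reaches all constants, the b for which b * t ^ N is reached form an
    ideal, so it suffices to reach the products of N generators. *)
Lemma rees_lift (S : comNzRingType) (phi : {rmorphism S -> {poly R}}) (y : seq R) N :
    (forall b, exists z, phi z = b%:P) ->
    (forall a, a \in y -> exists z, phi z = a *: 'X) ->
  ipow (gen [set` y]) N `<=` [set b | exists z, phi z = b *: 'X^N].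
Proof.
move=> phiC phiX.
have iL (q : {poly R}) : ideal [set b | exists z, phi z = b *: q].
  split=> [|u v [z bz] [w bw]|r u [z bz]] /=.
  - by exists 0; rewrite rmorph0 scale0r.
  - by exists (z + w); rewrite rmorphD bz bw scalerDl.
  - by have [t rt] := phiC r; exists (t * z); rewrite rmorphM bz rt mul_polyC scalerA.
elim: N => [b _|N IH].
  by have [z bz] := phiC b; exists z; rewrite bz expr0 alg_polyC.
apply: gen_sub => // _ [a [b [Ma /IH[z bz] ->]]] /=.
have [w aw] : [set a | exists z, phi z = a *: 'X] a by apply: (gen_sub (iL _) _ Ma).
by exists (w * z); rewrite rmorphM aw bz -scalerAl -scalerAr scalerA exprS.
Qed.

(** The elements z whose image in R[t] has all its coefficients in P + (x) form an
    ideal B of the Noetherian ring S. Finitely many generators suffice for B, and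
    their images have degree below some c. Expressing z through them, with
    multipliers whose coefficients in degree j lie in M ^ j, shows that the
    coefficient of t ^ k is in x * M ^ (k - c) + P. Applied to b * x - p in M ^ N,
    placed in degree N, this gives b * x = b' * x modulo P with b' in
    M ^ (N - c), and x cancels since P is prime. *)
Lemma artin_rees_colon (M P : set R) (x : R) :
    noetherian R -> ideal M -> prime_ideal P -> ~ P x ->
  exists c, forall N b,
    isum P (ipow M N) (b * x) -> isum P (ipow M (N - c)) b.
Proof.
move=> hN iM [iP _ Pprime] Px.
have [y My] := hN _ iM.
have [|S [phi [hS phiC phiX phiM]]] := @rees_presentation M y hN iM.
  by rewrite My => u; exact: mem_gen.
have iA := ideal_adjoin x iP.
pose B := [set z | forall k, adjoin P x (phi z)`_k].
have iB : ideal B.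
  split=> [k|z w Bz Bw k|r z Bz k].
  - by rewrite rmorph0 coef0; exact: ideal0.
  - by rewrite rmorphD coefD; exact: idealD.
  - rewrite rmorphM coefM; apply: (big_ind (adjoin P x)) => [|u v|j _].
    + exact: ideal0.
    + exact: idealD.
    + exact: idealM.
have [s Bs] := hS _ iB.
pose c := \max_(z <- s) size (phi z).
(* The truncated subtraction is intended: in degrees below c there is no
   constraint on b', so this set is then P + (x). *)
pose C k := [set b | exists2 b', ipow M (k - c) b' & P (b - b' * x)].
have iC k : ideal (C k).
  split=> [|u v [u' Mu Pu] [v' Mv Pv]|r u [u' Mu Pu]].
  - exists 0; first exact: (ideal0 (ideal_ipow M _)).
    by rewrite mul0r subr0; exact: ideal0.
  - exists (u' + v'); first exact: (idealD (ideal_ipow M _)).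
    by rewrite mulrDl opprD addrACA; exact: idealD.
  - exists (r * u'); first exact: (idealM _ (ideal_ipow M _)).
    by rewrite -mulrA -mulrBr; exact: idealM.
pose W := [set z | forall k, C k (phi z)`_k].
have iW : ideal W.
  split=> [k|z w Wz Ww k|r z Wz k].
  - by rewrite rmorph0 coef0; exact: ideal0.
  - by rewrite rmorphD coefD; exact: idealD.
  - rewrite rmorphM coefM; apply: (big_ind (C k)) => [|u v|j _].
    + exact: ideal0.
    + exact: idealD.
    + have [b Mb Pb] := Wz (k - j)%N.
      exists ((phi r)`_j * b); last first.
        by rewrite -mulrA -mulrBr; exact: idealM.
      have := ipow_mul (phiM r j) Mb; apply: ipow_le; lia.
have BW : B `<=` W.
  rewrite Bs; apply: gen_sub => // z /= zs k.
  have [kc|ck] := ltnP k c.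
    have [a Pa] : adjoin P x (phi z)`_k.
      by have : B z by rewrite Bs; exact: mem_gen.
    by exists a => //; have -> : (k - c = 0)%N by lia.
  rewrite nth_default; first exact: ideal0.
  by apply: leq_trans ck; rewrite /c (big_rem z)//= leq_maxl.
exists c => N b [p Pp]; rewrite My => /(rees_lift phiC phiX)[z bz].
have /BW/(_ N) : B z.
  move=> k; rewrite bz coefZ coefXn; case: eqP => _; last first.
    by rewrite mulr0; exact: ideal0.
  exists b; rewrite mulr1 addrAC subrr add0r -mulN1r; exact: idealM.
rewrite bz coefZ coefXn eqxx mulr1 => -[b' Mb' Pb'].
exists (b - b'); last by rewrite subKr -My.
have /Pprime[] // : P ((b - b') * x).
have -> : (b - b') * x = (b * x - p - b' * x) + p by ring.
exact: idealD.
Qed.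

End ArtinRees.

(** * Growth of lengths along a chain of primes *)

Section Growth.
Variable R : comNzRingType.
Implicit Types M P : set R.

(** A lower bound of degree n for the Hilbert-Samuel function of R / P. *)
Definition grows M P n := exists C, forall q N, (C * q < N)%N ->
  length_ge (isum P (ipow M N)) (q ^ n).

(** For N > 0 the ideal P + M ^ N is proper, so the length is at least 1. *)
Lemma grows0 M P : maximal_ideal M -> P `<=` M -> grows M P 0.
Proof.
move=> [iM MT _] PM; exists 0%N => q [|N]// _; exists [:: 1] => //=; split=> //.
move=> /(isum_sub iM PM (ipow_sub iM (ltn0Sn N))) /(ideal1 iM).
exact: MT.
Qed.

(** Multiplication by an element x of P1 outside P0 splits the length for P0 at N
    into at least the length for P1 at N plus the length for P0 at N - c. *)
Lemma growsS M P0 P1 n : noetherian R -> ideal M ->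
  prime_ideal P0 -> prime_ideal P1 -> P0 `<` P1 ->
  grows M P1 n -> grows M P0 n.+1.
Proof.
move=> hN iM P0prime P1prime [P01 /nonsubset[x [P1x P0x]]] [C P1C].
have [[iP0 _ _] [iP1 _ _]] := (P0prime, P1prime).
have [c colonP] := artin_rees_colon hN iM P0prime P0x.
have iMN N := ideal_ipow M N.
(* Splitting i times along x; each splitting gains q ^ n and costs c. *)
have step q i N : (C * q + c * i < N)%N ->
    length_ge (isum P0 (ipow M N)) (i * q ^ n).
  elim: i N => [|i IH] N CN; first by exists [::].
  rewrite mulSn; apply: (@length_ge_split _ _ x); first exact: ideal_isum.
  - apply: (@length_ge_mono _ _ (isum P1 (ipow M N))); last by apply: P1C; lia.
    apply: adjoin_sub; first exact: ideal_isum.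
      by move=> z [a /P01 P1a Mz]; exists a.
    exact: sub_isuml.
  - apply: (@length_ge_mono _ _ (isum P0 (ipow M (N - c)))).
      by move=> b; exact: colonP.
    by apply: IH; lia.
exists (C + c)%N => q N CN; rewrite expnS; apply: step; lia.
Qed.

Lemma grows_le M P n (y : seq R) : maximal_ideal M -> M = gen [set` y] ->
  ideal P -> grows M P n -> (n <= size y)%N.
Proof.
move=> Mmax My iP [C PC]; rewrite leqNgt; apply/negP => yn.
set d := size y in yn.
have qn q : (q ^ n <= (C * q).+1 ^ d)%N.
  have [s Ps qs] := PC q _ (ltnSn (C * q)).
  apply: leq_trans qs _; apply: (length_le_ipow Mmax My).
  by apply: indep_mono Ps; exact: sub_isumr.
(* The bound reads q ^ n <= (C * q + 1) ^ d <= (C + 1) ^ d * q ^ d, which fails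
   for n > d as soon as q > (C + 1) ^ d. *)
have {qn} := qn (C.+1 ^ d).+1; set q := (C.+1 ^ d).+1.
apply/negP; rewrite -ltnNge; apply: (@leq_trans (q ^ d.+1)); last exact: leq_pexp2l.
rewrite expnS; apply: (@leq_ltn_trans ((C.+1 * q) ^ d)).
  case: (posnP d) => [->//|d_gt0].
  by rewrite leq_exp2r// mulSn -[(C * q).+1]add1n leq_add2r.
by rewrite expnMn ltn_pmul2r ?expn_gt0.
Qed.

End Growth.

(** * Irreducible closed sets and prime ideals *)

Section ClosedIrreducible.
Variable R : comPzRingType.
Implicit Types (V : set (QPrim R)).

Definition vanishing V : set R :=
  [set x | forall Q, V Q -> radical (qprim_ideal Q) x].

Lemma ideal_vanishing V : ideal (vanishing V).
Proof.
split=> [Q _|x y Vx Vy Q VQ|a x Vx Q VQ]; have [iQ _ _] := prime_radical Q.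
- exact: ideal0.
- by apply: idealD => //; [exact: Vx|exact: Vy].
- by apply: idealM => //; exact: Vx.
Qed.

(** The Galois connection between ideals and sets of quasi-primary ideals: if
    V = Vq I, then I is contained in [vanishing V]. *)
Lemma Vq_vanishing V : closed V -> Vq (vanishing V) = V.
Proof.
move=> /closed_QPrimP[I iI VI]; apply/seteqP; split=> Q VQ.
  by rewrite VI => x Ix; apply: VQ => Q'; rewrite VI; exact.
by move=> x; exact.
Qed.

Lemma vanishing_proper V V' : closed V -> closed V' -> V `<` V' ->
  vanishing V' `<` vanishing V.
Proof.
move=> cV cV' [VV' V'V]; split=> [x V'x Q /VV'|sub]; first exact: V'x.
apply: V'V; rewrite -(Vq_vanishing cV) -(Vq_vanishing cV') => Q.
exact: subset_trans.
Qed.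

(** If x * y vanishes on V, each radical being prime, V is covered by the zero
    loci of x and y; irreducibility makes one of them all of V. *)
Lemma prime_vanishing V : irreducible_set V -> prime_ideal (vanishing V).
Proof.
move=> [[[Q0 VQ0] _] irr]; split; first exact: ideal_vanishing.
  move=> VT; have /prime1 := prime_radical Q0; apply.
  by have : vanishing V 1 by [rewrite VT]; apply; rewrite -in_setE.
move=> x y Vxy; apply: contrapT => /not_orP[Vx Vy]; apply: irr.
pose A (z : R) : set (set_type V) :=
  set_val @^-1` (Vq (gen [set z])).
have AP z Q : A z Q <-> radical (qprim_ideal (set_val Q)) z.
  rewrite /A/=; have [iQ _ _] := prime_radical (set_val Q); split.
    by apply; exact: mem_gen.
  by move=> Qz; apply: gen_sub => // _ ->.
have cA z : closed (A z).
  have /continuous_closedP : continuous (set_val : set_type V -> QPrim R).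
    exact: initial_continuous.
  by apply; apply/closed_QPrimP; exists (gen [set z]) => //; exact: ideal_smallest.
have A_proper z : ~ vanishing V z -> A z `<` setT.
  move=> Vz; split=> // sub; apply: Vz => Q VQ.
  by have /AP := sub (SigSub (mem_set VQ)) I.
exists (A x), (A y); split=> //; try exact: A_proper.
apply/seteqP; split=> // Q _.
have [_ _ Qprime] := prime_radical (set_val Q).
have /Qprime[] : radical (qprim_ideal (set_val Q)) (x * y).
- by apply: Vxy; exact: set_valP.
- by left; apply/AP.
- by right; apply/AP.
Qed.

End ClosedIrreducible.

(** * Finiteness of the dimension *)

(** The k-th closed set of the chain has k smaller ones below it, hence its prime
    has k strictly larger primes above it, and its length function grows with
    degree at least k. *)
Lemma chain_length_le (R : comNzRingType) (M : set R) (y : seq R) (m : nat)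
    (V : 'I_m -> set (QPrim R)) :
  noetherian R -> local_ring R -> maximal_ideal M -> M = gen [set` y] ->
  irreducible_closed_chain V -> (m <= (size y).+1)%N.
Proof.
move=> hN hL Mmax My [cV V_lt].
have Vprime i : prime_ideal (vanishing (V i)).
  by apply: prime_vanishing; have [] := cV i.
have Vgrows k (km : (k < m)%N) : grows M (vanishing (V (Ordinal km))) k.
  elim: k km => [|k IH] km.
    apply: grows0 => //; have [iV _ _] := Vprime (Ordinal km).
    apply: local_sub_maximal => //; exact: prime1.
  apply: growsS (IH (ltnW km)) => //; first by case: Mmax.
  have closedV i : closed (V i) by have [] := cV i.
  by apply: vanishing_proper => //; exact: V_lt.
case: m V cV V_lt Vprime Vgrows => // m V _ _ Vprime Vgrows.
rewrite ltnS; apply: (grows_le Mmax My _ (Vgrows m (ltnSn m))).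
by have [] := Vprime (Ordinal (ltnSn m)).
Qed.

Lemma has_dimension_bounded (T : topologicalType) (d : nat) :
  (forall (m : nat) (V : 'I_m -> set T), irreducible_closed_chain V -> (m <= d)%N) ->
  exists n, has_dimension T n.
Proof.
move=> bound.
pose P := fun m : nat => `[< exists V : 'I_m -> set T, irreducible_closed_chain V >].
have exP : exists m, P m.
  by exists 0%N; apply/asboolP; exists (fun=> setT); split=> -[].
have Pd m : P m -> (m <= d)%N by move=> /asboolP[V]; exact: bound.
have [n /asboolP Pn n_max] := ex_maxnP exP Pd.
by exists n; split=> // m V cV; apply: n_max; apply/asboolP; exists V.
Qed.

(** The Rees algebra is built inside R[t], whose structure includes 1 != 0, so
    the nontriviality of R has to become part of its structure as well. *)
Definition nontrivial_comNzRing (R : comPzRingType) (nz : (1 : R) != 0) :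
  comNzRingType := HB.pack R (GRing.PzSemiRing_isNonZero.Build R nz).

(** Records have no eta-conversion here, so the two structures on R are
    convertible only after [R] has been destructed. *)
Lemma nontrivial_comNzRingE (R : comPzRingType) (nz : (1 : R) != 0) :
  nontrivial_comNzRing nz = R :> comPzRingType.
Proof. by case: R nz => T [*]. Qed.

Theorem theorem2p15 (R : comPzRingType) (hN : noetherian R) (hL : local_ring R) :
  exists n : nat, has_dimension (QPrim R) n.
Proof.
have nz : (1 : R) != 0.
  apply/eqP => R10; have [M [[iM MT _] _]] := hL; apply: MT; apply: ideal1 => //.
  by rewrite R10; exact: ideal0.
rewrite -(nontrivial_comNzRingE nz) in hN hL *.
have [M [Mmax _]] := hL; have [iM _ _] := Mmax.
have [y My] := hN M iM.
apply: (@has_dimension_bounded _ (size y).+1) => m V.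
exact: (chain_length_le hN hL Mmax My).
Qed.
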